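(* Let $A$ be a commutative unital complex Banach algebra such that $A$ is Arens regular and $A^{**}$ is semisimple. If $A^{**}$ is a BSE algebra and $\widehat{A}|_{\Delta(A)}\cong\widehat{A^{**}}|_{\widehat{\Delta(A)}}$, then $A$ is a BSE algebra.
   Context: For a commutative Banach algebra $B$, $\Delta(B)$ is the set of all nonzero multiplicative linear functionals on $B$, with the Gelfand (relative weak-$*$) topology, and $C_b(\Delta(B))$ is the space of bounded continuous complex-valued functions on $\Delta(B)$. $B$ is semisimple if $\bigcap_{\varphi\in\Delta(B)}\ker\varphi=\{0\}$. BSE functions: $\sigma\in C_b(\Delta(B))$ is a BSE function if there is $\beta>0$ such that for all $n$, all $c_1,\dots,c_n\in\mathbb{C}$ and all $\varphi_1,\dots,\varphi_n\in\Delta(B)$, $|\sum_{j=1}^n c_j\sigma(\varphi_j)|\le\beta\|\sum_{j=1}^n c_j\varphi_j\|_{B^*}$. $C_{\mathrm{BSE}}(\Delta(B))$ is the set of all BSE functions. BSE algebra: a multiplier of $B$ is a linear operator $T$ on $B$ with $T(xy)=xT(y)$ for all $x,y\in B$; $M(B)$ is the set of multipliers, and for $T\in M(B)$, $\widehat T$ is the bounded continuous function on $\Delta(B)$ with $\varphi(Tx)=\widehat T(\varphi)\varphi(x)$ for all $x\in B$, $\varphi\in\Delta(B)$. $B$ is a BSE algebra if $\widehat{M(B)}:=\{\widehat T:T\in M(B)\}$ equals $C_{\mathrm{BSE}}(\Delta(B))$. For unital $B$ this means that $\{\hat b:b\in B\}=C_{\mathrm{BSE}}(\Delta(B))$, where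 $\hat b(\varphi)=\varphi(b)$. Arens products on $A^{**}$: for $F,G\in A^{**}$, $f\in A^*$, $x,y\in A$, the first Arens product is $(F\square G)(f)=F(G.f)$, where $(G.f)(x)=G(f.x)$ and $(f.x)(y)=f(xy)$; the second is $(F\lozenge G)(f)=G(f.F)$, where $(f.F)(x)=F(x.f)$ and $(x.f)(y)=f(yx)$. $A$ is Arens regular if $\square=\lozenge$; in that case, for commutative $A$, $A^{**}$ is a commutative Banach algebra under this product. Notation in the hypothesis: for $\varphi\in\Delta(A)$, $\hat\varphi\in\Delta(A^{**})$ is given by $\hat\varphi(F)=F(\varphi)$, and $\widehat{\Delta(A)}=\{\hat\varphi:\varphi\in\Delta(A)\}$. $\widehat A|_{\Delta(A)}$ is the set of functions $\varphi\mapsto\varphi(a)$ ($a\in A$) on $\Delta(A)$, and $\widehat{A^{**}}|_{\widehat{\Delta(A)}}$ is the set of functions $\hat\varphi\mapsto\hat\varphi(F)=F(\varphi)$ ($F\in A^{**}$) on $\widehat{\Delta(A)}$. The relation $\widehat{A}|_{\Delta(A)}\cong\widehat{A^{**}}|_{\widehat{\Delta(A)}}$ means that these two sets of functions coincide when $\varphi$ is identified with $\hat\varphi$, i.e. for every $F\in A^{**}$ there is $a\in A$ with $F(\varphi)=\varphi(a)$ for all $\varphi\in\Delta(A)$. *)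

(* Defs.v *)
From HB Require Import structures.
From mathcomp Require Import all_boot all_order all_algebra.
From mathcomp Require Import complex.
From mathcomp Require Import all_classical all_reals all_analysis.
Set Implicit Arguments.
Unset Strict Implicit.
Unset Printing Implicit Defensive.
Import Order.TTheory GRing.Theory Num.Theory.
Import numFieldNormedType.Exports.
Local Open Scope classical_set_scope.
Local Open Scope complex_scope.
Local Open Scope ring_scope.

(* A Banach algebra need not be unital here, and the zero algebra is allowed,
   so the product cannot be taken from the ring hierarchy. When there is a unit,
   its norm is not assumed to be 1. *)
HB.mixin Record hasComBanachMul (K : numFieldType) V
    of CompleteNormedModule K V := {
  bmul : V -> V -> V;
  bmulA : associative bmul;
  bmulC : commutative bmul;
  bmulDl : left_distributive bmul +%R;
  bmulZl : forall (a : K) (x y : V), bmul (a *: x) y = a *: bmul x y;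
  ler_norm_bmul : forall x y : V, `|bmul x y| <= `|x| * `|y|
}.

#[short(type="comBanachAlgType")]
HB.structure Definition ComBanachAlgebra (K : numFieldType) :=
  {A of hasComBanachMul K A & CompleteNormedModule K A}.

Section BmulTheory.
Variables (K : numFieldType) (A : comBanachAlgType K).
Implicit Types x y z : A.

Lemma bmulDr x y z : bmul x (y + z) = bmul x y + bmul x z.
Proof. by rewrite bmulC bmulDl !(bmulC x). Qed.

Lemma bmulZr (a : K) x y : bmul x (a *: y) = a *: bmul x y.
Proof. by rewrite bmulC bmulZl bmulC. Qed.

Lemma bmulBr x y z : bmul x (y - z) = bmul x y - bmul x z.
Proof. by rewrite -scaleN1r bmulDr bmulZr scaleN1r. Qed.

Lemma bmulx0 x : bmul x 0 = 0.
Proof. by rewrite -(scale0r 0) bmulZr !scale0r. Qed.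

End BmulTheory.

Section ComplexComplete.
Variable R : realType.
Local Notation C := R[i].

Lemma Re_norm (V : normedModType C) (x : V) : (complex.Re `|x|)%:C = `|x|.
Proof. exact/RRe_real/normr_real. Qed.

Lemma le_norm_ReIm (z : C) :
  `|z| <= (`|complex.Re z| + `|complex.Im z|)%:C.
Proof.
have nR (r : R) : `|r%:C| = `|r|%:C.
  by rewrite normc_def /= expr0n /= addr0 sqrtr_sqr.
rewrite {1}(complexE z) (le_trans (ler_normD _ _))//.
rewrite normrM complexiE normCi mul1r !nR.
by rewrite rmorphD.
Qed.

Lemma ReB (a b : C) : complex.Re (a - b) = complex.Re a - complex.Re b.
Proof. by case: a; case: b. Qed.

Lemma ImB (a b : C) : complex.Im (a - b) = complex.Im a - complex.Im b.
Proof. by case: a; case: b. Qed.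

Lemma norm_Re_le (z : C) : `|complex.Re z|%:C <= `|z|.
Proof. exact: normc_ge_Re. Qed.

Lemma norm_Im_le (z : C) : `|complex.Im z|%:C <= `|z|.
Proof.
have := normc_ge_Re (z * 'i%C).
by rewrite ReiNIm normrN normrM complexiE normCi mulr1.
Qed.

Lemma complex_complete (F : set_system C^o) :
  ProperFilter F -> cauchy F -> cvg F.
Proof.
move=> PF /cauchyP Fc.
have part (p : C -> R) : (forall a b, p (a - b) = p a - p b) -> (forall z, `|p z|%:C <= `|z|) ->
    cvg (p @ F).
  move=> pB ple; apply: R_complete; apply/cauchyP => e e0.
  have [z Fz] := Fc e%:C ltac:(by rewrite -[0]/(0%:C) ltcR).
  exists (p z); rewrite /fmap /=.
  apply: (filterS _ Fz) => w; rewrite -!ball_normE /= => zw.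
  rewrite -(pB z w) -ltcR; apply: le_lt_trans zw; exact: ple.
have cR := part (@complex.Re R) ReB norm_Re_le.
have cI := part (@complex.Im R) ImB norm_Im_le.
apply/cvg_ex; exists (lim (@complex.Re R @ F) +i* lim (@complex.Im R @ F)).
apply/(@cvgrPdist_lt C C^o) => e e0.
have eE : e = (complex.Re e)%:C by rewrite RRe_real// gtr0_real.
have e20 : 0 < complex.Re e / 2 by rewrite divr_gt0// -ltcR -eE.
have /cvgrPdist_lt/(_ _ e20) FR := cR.
have /cvgrPdist_lt/(_ _ e20) FI := cI.
near=> z; rewrite (le_lt_trans (le_norm_ReIm _))// eE ltcR.
rewrite [ltRHS](splitr (complex.Re e)) ltrD//.
  by rewrite ReB; near: z.
by rewrite ImB; near: z.
Unshelve. all: by end_near. Qed.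

End ComplexComplete.

Section Dual.
Variables (R : realType) (V : normedModType R[i]).
Local Notation C := R[i].

Definition is_dual : {pred V -> C^o} :=
  fun f => `[< linear f /\ continuous f >].

Lemma is_dual_submod : submod_closed is_dual.
Proof.
split.
  apply/asboolP; split; last by move=> x; exact: cvg_cst.
  by move=> a u v /=; rewrite scaler0 addr0.
move=> a f g /asboolP[lf cf] /asboolP[lg cg]; apply/asboolP; split.
  move=> b u v; rewrite !fctE lf lg !scalerDr !scalerA (mulrC a b).
  by rewrite -!addrA; congr (_ + _); rewrite addrCA.
move=> x; apply: cvgD; last exact: cg.
by apply: cvgZl_tmp; exact: cf.
Qed.

HB.instance Definition _ :=
  GRing.isSubmodClosed.Build C (V -> C^o) is_dual is_dual_submod.

(* The topological dual of V. *)
Record cdual : Type :=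
  CDual { cdual_val :> V -> C^o; cdual_valP : cdual_val \in is_dual }.

HB.instance Definition _ := [isSub for cdual_val].
HB.instance Definition _ := [Choice of cdual by <:].
HB.instance Definition _ := [SubChoice_isSubLmodule of cdual by <:].

Lemma cdual_linear (f : cdual) : linear f.
Proof. by case: f => f /= /asboolP[]. Qed.

Lemma cdual_continuous (f : cdual) : continuous f.
Proof. by case: f => f /= /asboolP[]. Qed.

HB.instance Definition _ (f : cdual) :=
  GRing.isLinear.Build C V C^o _ (cdual_val f) (cdual_linear f).

Lemma cdual_eq (f g : cdual) : f =1 g -> f = g.
Proof. by move=> fg; apply/val_inj/funext. Qed.

Lemma cdualDE (f g : cdual) x : (f + g) x = f x + g x.
Proof. by []. Qed.

Lemma cdualZE (a : C) (f : cdual) x : (a *: f) x = a * f x.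
Proof. by []. Qed.

Lemma cdual_sumE n (f : 'I_n -> cdual) x :
  (\sum_i f i) x = \sum_i f i x.
Proof. by elim/big_ind2 : _ => // f1 g1 f2 g2 <- <-. Qed.

Implicit Types f g : cdual.

(* Norms on a normedModType R[i] are R[i]-valued, hence the detour through Re to
   take the supremum over the unit ball in R. *)
Definition cdual_norm (f : cdual) : C :=
  (sup [set complex.Re `|f x| | x in [set x : V | `|x| <= 1]])%:C.

Let cdual_bounded (f : cdual) :
  exists2 r : C, 0 < r & forall x, `|f x| <= r * `|x|.
Proof.
apply/pinfty_ex_gt0/linear_boundedP/linear_bounded_continuous.
exact: cdual_continuous.
Qed.

Let supS (f : cdual) :
  has_sup [set complex.Re `|f x| | x in [set x : V | `|x| <= 1]].
Proof.
split; first by exists (complex.Re `|f 0|), 0 => //=; rewrite normr0 ler01.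
have [r r0 fr] := cdual_bounded f.
exists (complex.Re r) => _ [x /= x1 <-].
rewrite -lecR !RRe_real ?normr_real ?gtr0_real//.
by rewrite (le_trans (fr x))// ler_piMr// ltW.
Qed.

Let cdual_norm_ge0 f : 0 <= cdual_norm f.
Proof.
rewrite ler0c; apply: le_trans (sup_upper_bound (supS f) (x := 0) _) => //.
by exists 0; rewrite /mkset ?linear0 normr0// ler01.
Qed.

Let le_cdual_norm f x : `|f x| <= cdual_norm f * `|x|.
Proof.
have [->|x0] := eqVneq x 0; first by rewrite linear0 !normr0 mulr0.
have nx0 : 0 < `|x| by rewrite normr_gt0.
rewrite -ler_pdivrMr// mulrC -[X in X * _]ger0_norm ?invr_ge0//.
rewrite -normrM -[_ * f x]/(_ *: f x) -linearZ /=.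
rewrite -[leLHS]RRe_real ?normr_real// lecR.
apply: sup_upper_bound; first exact: supS.
exists (`|x|^-1 *: x) => //=.
by rewrite normrZ ger0_norm ?invr_ge0// mulVf ?gt_eqF.
Qed.

Let cdual_norm_le f (r : C) :
  0 <= r -> (forall x, `|f x| <= r * `|x|) -> cdual_norm f <= r.
Proof.
move=> r0 fr; rewrite -[r]RRe_real ?ger0_real// lecR; apply: ge_sup.
  by case: (supS f).
move=> _ [x /= x1 <-]; rewrite -lecR !RRe_real ?normr_real ?ger0_real//.
by rewrite (le_trans (fr x))// ler_piMr.
Qed.

Lemma cdual_normD f g : cdual_norm (f + g) <= cdual_norm f + cdual_norm g.
Proof.
apply: cdual_norm_le => [|x]; first exact: addr_ge0.
rewrite cdualDE (le_trans (ler_normD _ _))// mulrDl.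
by rewrite lerD.
Qed.

Lemma cdual_normZ (a : C) f : cdual_norm (a *: f) = `|a| * cdual_norm f.
Proof.
have le b g : cdual_norm (b *: g) <= `|b| * cdual_norm g.
  apply: cdual_norm_le => [|x]; first exact: mulr_ge0.
  by rewrite cdualZE normrM -mulrA ler_wpM2l.
apply/eqP; rewrite eq_le le /=.
have [->|a0] := eqVneq a 0; first by rewrite normr0 mul0r.
rewrite -ler_pdivlMl ?normr_gt0// -normfV (le_trans _ (le _ _))//.
by rewrite scalerA mulVf// scale1r.
Qed.

Lemma cdual_norm0_eq0 f : cdual_norm f = 0 -> f = 0.
Proof.
move=> f0; apply: cdual_eq => x; apply/eqP; rewrite -normr_le0.
by rewrite (le_trans (le_cdual_norm f x))// f0 mul0r.
Qed.

HB.instance Definition _ :=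
  Lmodule_isNormed.Build C cdual cdual_normD cdual_normZ cdual_norm0_eq0.

Lemma ler_norm_cdual (f : cdual) x : `|f x| <= `|f| * `|x|.
Proof. exact: le_cdual_norm. Qed.

Lemma ler_cdual_norm (f : cdual) (r : C) :
  0 <= r -> (forall x, `|f x| <= r * `|x|) -> `|f| <= r.
Proof. exact: cdual_norm_le. Qed.

Lemma bounded_is_dual (g : V -> C^o) (r : C) :
  linear g -> (forall x, `|g x| <= r * `|x|) -> g \in is_dual.
Proof.
move=> lg gr; apply/asboolP; split => //.
pose gl := GRing.isLinear.Build C V C^o _ g lg.
pose G : {linear V -> C^o} := HB.pack g gl.
apply: (@bounded_linear_continuous _ _ _ G).
apply/ex_bound; exists `|r|; apply/nbhs_norm0P; exists 1 => //= x /= x1.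
rewrite (le_trans (gr x))//.
have [->|x0] := eqVneq x 0; first by rewrite normr0 mulr0.
have r0 : 0 <= r.
  by rewrite -(pmulr_lge0 _ (_ : 0 < `|x|)) ?normr_gt0// (le_trans _ (gr x)).
by rewrite ger0_norm// ler_piMr// ltW.
Qed.

Definition bounded_cdual (g : V -> C^o) (r : C) (lg : linear g)
    (gr : forall x, `|g x| <= r * `|x|) : cdual :=
  CDual (bounded_is_dual lg gr).

Lemma cdual_complete (F : set_system cdual) :
  ProperFilter F -> cauchy F -> cvg F.
Proof.
move=> PF /cauchyP Fc.
pose ev x (h : cdual) : C^o := h x.
have cev x : cvg (ev x @ F).
  apply: complex_complete; apply/cauchyP => e e0.
  have e1 : 0 < e / (`|x| + 1).
    by rewrite divr_gt0// (lt_le_trans ltr01)// lerDr.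
  have [g Fg] := Fc _ e1; exists (g x); rewrite /fmap /=.
  apply: (filterS _ Fg) => h.
  rewrite -!ball_normE /= => gh.
  rewrite (_ : ev x h = h x)// -[g x - h x]/((g - h) x).
  rewrite (le_lt_trans (ler_norm_cdual _ _))//.
  rewrite (@le_lt_trans _ _ (`|g - h| * (`|x| + 1)))//.
    by rewrite ler_wpM2l// lerDl.
  by rewrite -ltr_pdivlMr// (lt_le_trans ltr01)// lerDr.
pose l x : C^o := lim (ev x @ F).
have ll : linear l.
  move=> a u v; apply: (@cvg_unique _ (@norm_hausdorff _ C^o) (ev (a *: u + v) @ F)).
    exact: cev.
  rewrite (_ : ev (a *: u + v) = (a \*: ev u) + ev v); last first.
    by apply/funext => h; rewrite /ev linearP.
  by apply: cvgD; [apply: cvgZl_tmp|]; exact: cev.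
have lg (g : cdual) e : 0 < e -> F (ball g e) ->
    forall x, `|l x - g x| <= e * `|x|.
  move=> e0 Fg x; apply/ler_addgt0Pr => d d0.
  have /cvgrPdist_lt/(_ _ d0) Fl := cev x.
  have [h [/= lh]] := filter_ex (filterI Fl Fg).
  rewrite -ball_normE /= => gh.
  rewrite -(subrKA (h x)) (le_trans (ler_normD _ _))// addrC lerD//; last exact: ltW.
  rewrite -[h x - g x]/((h - g) x) (le_trans (ler_norm_cdual _ _))//.
  by rewrite ler_wpM2r// distrC ltW.
have [g0 Fg0] := Fc 1 ltr01.
have lb x : `|l x| <= (1 + `|g0|) * `|x|.
  rewrite -[l x](subrK (g0 x)) (le_trans (ler_normD _ _))// mulrDl lerD//.
  exact: lg.
pose L := bounded_cdual ll lb.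
apply/cvg_ex; exists L; apply/cvgrPdist_lt => e e0.
have e20 : 0 < e / 2 by rewrite divr_gt0.
have [g Fg] := Fc _ e20; apply: filterS (Fg) => h.
rewrite -ball_normE /= => gh.
rewrite -(subrKA g) (le_lt_trans (ler_normD _ _))// [ltRHS](splitr e).
rewrite ler_ltD// ler_cdual_norm// ?ltW// => x.
exact: lg.
Qed.

HB.instance Definition _ := Uniform_isComplete.Build cdual cdual_complete.

End Dual.

Section Spectrum.
Variables (R : realType) (B : comBanachAlgType R[i]).
Local Notation C := R[i].

Definition is_char : {pred (B -> C^o)} :=
  fun f => `[< [/\ linear f, forall x y, f (bmul x y) = f x * f y
                & exists x, f x != 0] >].

Record character : Type :=
  Character { char_val :> B -> C^o; char_valP : char_val \in is_char }.

HB.instance Definition _ := [isSub for char_val].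
HB.instance Definition _ := [Choice of character by <:].

(* Gelfand topology: the relative weak-* topology is the topology of pointwise
   convergence on B. *)
HB.instance Definition _ := Topological.copy character
  (initial_topology (char_val : character -> {ptws B -> C^o})).

Implicit Type phi : character.

Lemma char_linear phi : linear phi.
Proof. by case: phi => f /= /asboolP[]. Qed.

HB.instance Definition _ phi :=
  GRing.isLinear.Build C B C^o _ (char_val phi) (char_linear phi).

Lemma charM phi x y : phi (bmul x y) = phi x * phi y.
Proof. by case: phi => f /= /asboolP[]. Qed.

Lemma char_neq0 phi : exists x, phi x != 0.
Proof. by case: phi => f /= /asboolP[]. Qed.

Let quasi_inverse (y : B) : `|y| < 1 -> exists s, s = y + bmul y s.
Proof.
move=> y1.
pose g (s : B) := y + bmul y s; pose s n := iter n g 0.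
have gB a b : `|g a - g b| <= `|y| * `|a - b|.
  by rewrite /g opprD addrACA subrr add0r -bmulBr ler_norm_bmul.
have c0 : 0 < 1 - `|y| by rewrite subr_gt0.
pose M := (1 - `|y|)^-1; have M0 : 0 < M by rewrite invr_gt0.
have yM : 1 + `|y| * M = M.
  by rewrite -[1](mulfV (lt0r_neq0 c0)) -mulrDl subrK mul1r.
have sM n : `|s n| <= M.
  elim: n => [|n IH]; first by rewrite normr0 ltW.
  rewrite /s iterS -/(s n) -yM (le_trans (ler_normD _ _))// lerD//.
    exact: ltW.
  by rewrite (le_trans (ler_norm_bmul _ _))// ler_wpM2l.
have sB n m : `|s (n + m)%N - s n| <= `|y| ^+ n * M.
  elim: n => [|n IH]; first by rewrite add0n subr0 expr0 mul1r.
  rewrite addSn /s !iterS -/(s _) -/(s n) (le_trans (gB _ _))//.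
  by rewrite exprS -mulrA ler_wpM2l.
have yn (e : C) : 0 < e -> exists n, `|y| ^+ n * M < e.
  move=> e0.
  pose r := complex.Re `|y|; have rE : `|y| = r%:C by rewrite Re_norm.
  have eE : e / M = (complex.Re (e / M))%:C.
    by rewrite RRe_real// gtr0_real// divr_gt0.
  have eM : 0 < complex.Re (e / M) by rewrite -ltcR -eE divr_gt0.
  have r1 : `|r| < 1.
    by rewrite ger0_norm -?ler0c -?rE// -ltcR -rE.
  have /cvgrPdist_lt/(_ _ eM)[n _ /(_ n)] := cvg_expr r1.
  rewrite /= leqnn => /(_ isT); rewrite sub0r normrN => rn.
  exists n; rewrite -ltr_pdivlMr// eE rE -rmorphXn ltcR.
  exact: le_lt_trans (ler_norm _) rn.
have sc : cvg (s @ \oo).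
  apply/cauchy_cvgP/cauchyP => e e0; have [n ne] := yn _ e0.
  exists (s n); exists n => // m /= nm; rewrite -ball_normE /= distrC.
  by rewrite -(subnKC nm) (le_lt_trans (sB _ _)).
pose l := lim (s @ \oo); exists l.
apply/eqP; rewrite -subr_eq0 -normr_le0; apply/ler_addgt0Pr => e e0.
rewrite add0r; have e20 : 0 < e / 2 by rewrite divr_gt0.
have /cvgrPdist_lt/(_ _ e20)[n _ nl] := sc.
have nl0 := nl n (leqnn n); have nl1 := nl n.+1 (leqnSn n).
rewrite -(subrKA (s n.+1)) (le_trans (ler_normD _ _))// (splitr e) lerD//.
  exact: ltW.
rewrite /s iterS -/(s n) (le_trans (gB _ _))// distrC.
by rewrite (le_trans _ (ltW nl0))// ler_piMl// ltW.
Qed.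

Lemma ler_norm_char phi x : `|phi x| <= 1 * `|x|.
Proof.
rewrite mul1r real_leNgt ?normr_real//; apply/negP => xlt.
have p0 : phi x != 0 by rewrite -normr_gt0 (le_lt_trans _ xlt).
pose y := (phi x)^-1 *: x.
have py : phi y = 1 by rewrite linearZ /= -[_ *: _]/(_ * _) mulVf.
have [|s sE] := @quasi_inverse y.
  by rewrite normrZ normfV mulrC ltr_pdivrMr ?normr_gt0// mul1r.
have /eqP := congr1 phi sE.
rewrite linearD /= charM py mul1r -subr_eq0 opprD addrA addrAC subrr add0r.
by rewrite oppr_eq0 oner_eq0.
Qed.

(* Characters are not assumed continuous: ler_norm_char makes each of them an
   element of the topological dual. *)
Definition char_dual phi : cdual B :=
  bounded_cdual (char_linear phi) (ler_norm_char phi).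

Definition gelfand (b : B) : character -> C^o := fun phi => phi b.

Definition semisimple : Prop :=
  \bigcap_(phi in [set: character]) [set x : B | phi x = 0] = [set 0].

Definition Cb : set (character -> C^o) :=
  [set sigma | continuous sigma /\ bounded_fun sigma].

Definition C_BSE : set (character -> C^o) :=
  [set sigma | Cb sigma /\ exists2 beta : R, 0 < beta &
    forall (n : nat) (c : 'I_n -> C) (phi : 'I_n -> character),
      `|\sum_(j < n) c j * sigma (phi j)|
        <= beta%:C * `|\sum_(j < n) c j *: char_dual (phi j)|].

Definition multiplier : set {linear B -> B} :=
  [set T : {linear B -> B} | forall x y, T (bmul x y) = bmul x (T y)].

(* The value does not depend on the chosen x outside ker phi, see mult_hatE. *)
Definition mult_hat (T : {linear B -> B}) : character -> C^o :=
  fun phi => let x := xget 0 [set x | phi x != 0] in phi (T x) / phi x.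

Lemma mult_hatE T phi x :
  multiplier T -> phi (T x) = mult_hat T phi * phi x.
Proof.
move=> TM; rewrite /mult_hat.
have := char_neq0 phi; case: xgetP => [y _ /= y0 _|h [x0 px0]]; last first.
  by have := h x0; rewrite /= px0.
apply: (mulfI y0); rewrite -charM -TM bmulC TM charM.
by rewrite [RHS]mulrA mulrCA divff// mulr1 mulrC.
Qed.

Definition BSE_algebra : Prop := mult_hat @` multiplier = C_BSE.

Definition unital : Prop := exists e : B, forall x, bmul e x = x.

End Spectrum.

Section Arens.
Variables (R : realType) (A : comBanachAlgType R[i]).
Local Notation C := R[i].
Implicit Types (x y : A) (f : cdual A) (F G H : cdual (cdual A)).

(* Module actions, as f.x, x.f, G.f and f.F in the literature:
     ract f x = (y |-> f (x y))       lact x f = (y |-> f (y x))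
     bidual_ract G f = (x |-> G (f.x))
     bidual_lact f F = (x |-> F (x.f)). *)
Lemma ract_linear f x : linear (fun y => f (bmul x y) : C^o).
Proof. by move=> a u v; rewrite bmulDr bmulZr linearP. Qed.

Lemma ract_bound f x y : `|f (bmul x y)| <= `|f| * `|x| * `|y|.
Proof.
rewrite (le_trans (ler_norm_cdual _ _))// -mulrA ler_wpM2l//.
exact: ler_norm_bmul.
Qed.

Definition ract f x : cdual A := bounded_cdual (ract_linear f x) (ract_bound f x).

Lemma lact_linear x f : linear (fun y => f (bmul y x) : C^o).
Proof. by move=> a u v; rewrite bmulDl bmulZl linearP. Qed.

Lemma lact_bound x f y : `|f (bmul y x)| <= `|f| * `|x| * `|y|.
Proof. by rewrite bmulC ract_bound. Qed.

Definition lact x f : cdual A := bounded_cdual (lact_linear x f) (lact_bound x f).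

Lemma ler_norm_ract f x : `|ract f x| <= `|f| * `|x|.
Proof.
by apply: ler_cdual_norm => [|y]; [exact: mulr_ge0|exact: ract_bound].
Qed.

Lemma ler_norm_lact x f : `|lact x f| <= `|f| * `|x|.
Proof.
by apply: ler_cdual_norm => [|y]; [exact: mulr_ge0|exact: lact_bound].
Qed.

Lemma ractP f (a : C) x y : ract f (a *: x + y) = a *: ract f x + ract f y.
Proof.
apply: cdual_eq => z.
by rewrite cdualDE cdualZE /= bmulDl bmulZl linearP.
Qed.

Lemma lactP (a : C) x y f : lact (a *: x + y) f = a *: lact x f + lact y f.
Proof.
apply: cdual_eq => z.
by rewrite cdualDE cdualZE /= bmulDr bmulZr linearP.
Qed.

Lemma bidual_ract_linear G f : linear (fun x => G (ract f x) : C^o).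
Proof. by move=> a u v; rewrite ractP linearP. Qed.

Lemma bidual_ract_bound G f x : `|G (ract f x)| <= `|G| * `|f| * `|x|.
Proof.
rewrite (le_trans (ler_norm_cdual _ _))// -mulrA ler_wpM2l//.
exact: ler_norm_ract.
Qed.

Definition bidual_ract G f : cdual A :=
  bounded_cdual (bidual_ract_linear G f) (bidual_ract_bound G f).

Lemma bidual_lact_linear f F : linear (fun x => F (lact x f) : C^o).
Proof. by move=> a u v; rewrite lactP linearP. Qed.

Lemma bidual_lact_bound f F x : `|F (lact x f)| <= `|F| * `|f| * `|x|.
Proof.
rewrite (le_trans (ler_norm_cdual _ _))// -mulrA ler_wpM2l//.
exact: ler_norm_lact.
Qed.

Definition bidual_lact f F : cdual A :=
  bounded_cdual (bidual_lact_linear f F) (bidual_lact_bound f F).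

Lemma ler_norm_bidual_ract G f : `|bidual_ract G f| <= `|G| * `|f|.
Proof.
by apply: ler_cdual_norm => [|y]; [exact: mulr_ge0|exact: bidual_ract_bound].
Qed.

Lemma ler_norm_bidual_lact f F : `|bidual_lact f F| <= `|F| * `|f|.
Proof.
by apply: ler_cdual_norm => [|y]; [exact: mulr_ge0|exact: bidual_lact_bound].
Qed.

Lemma bidual_ractP G (a : C) f g :
  bidual_ract G (a *: f + g) = a *: bidual_ract G f + bidual_ract G g.
Proof.
apply: cdual_eq => x; rewrite cdualDE cdualZE /=.
by rewrite -[_ * G _]/(_ *: G _) -linearP; congr (G _); apply: cdual_eq.
Qed.

Lemma bidual_lactP (a : C) f g F :
  bidual_lact (a *: f + g) F = a *: bidual_lact f F + bidual_lact g F.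
Proof.
apply: cdual_eq => x; rewrite cdualDE cdualZE /=.
by rewrite -[_ * F _]/(_ *: F _) -linearP; congr (F _); apply: cdual_eq.
Qed.

Lemma arens1_linear F G : linear (fun f => F (bidual_ract G f) : C^o).
Proof. by move=> a f g; rewrite bidual_ractP linearP. Qed.

Lemma arens1_bound F G f : `|F (bidual_ract G f)| <= `|F| * `|G| * `|f|.
Proof.
rewrite (le_trans (ler_norm_cdual _ _))// -mulrA ler_wpM2l//.
exact: ler_norm_bidual_ract.
Qed.

Definition arens1 F G : cdual (cdual A) :=
  bounded_cdual (arens1_linear F G) (arens1_bound F G).

Lemma arens2_linear F G : linear (fun f => G (bidual_lact f F) : C^o).
Proof. by move=> a f g; rewrite bidual_lactP linearP. Qed.

Lemma arens2_bound F G f : `|G (bidual_lact f F)| <= `|G| * `|F| * `|f|.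
Proof.
rewrite (le_trans (ler_norm_cdual _ _))// -mulrA ler_wpM2l//.
exact: ler_norm_bidual_lact.
Qed.

Definition arens2 F G : cdual (cdual A) :=
  bounded_cdual (arens2_linear F G) (arens2_bound F G).

Definition arens_regular : Prop := arens1 = arens2.

Lemma arens1A : associative arens1.
Proof.
move=> F G H; apply: cdual_eq => f /=; congr (F _).
apply: cdual_eq => x /=; congr (G _); apply: cdual_eq => y /=.
by congr (H _); apply: cdual_eq => z /=; rewrite bmulA.
Qed.

Lemma arens1Dl : left_distributive arens1 +%R.
Proof. by move=> F G H; apply: cdual_eq. Qed.

Lemma arens1Zl (a : C) F G : arens1 (a *: F) G = a *: arens1 F G.
Proof. exact: cdual_eq. Qed.

Lemma ler_norm_arens1 F G : `|arens1 F G| <= `|F| * `|G|.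
Proof.
by apply: ler_cdual_norm => [|f]; [exact: mulr_ge0|exact: arens1_bound].
Qed.

Lemma arens12 F G : arens2 F G = arens1 G F.
Proof.
apply: cdual_eq => f /=; congr (G _); apply: cdual_eq => x /=; congr (F _).
by apply: cdual_eq => y /=; rewrite bmulC.
Qed.

Lemma arens1C : arens_regular -> commutative arens1.
Proof. by move=> reg F G; rewrite -arens12 reg. Qed.

End Arens.

(* The second dual as a commutative Banach algebra; it depends on the proof of
   Arens regularity because commutativity of the product does. *)
Definition arens_bidual (R : realType) (A : comBanachAlgType R[i])
  (reg : arens_regular A) : Type := cdual (cdual A).

Section ArensBidual.
Variables (R : realType) (A : comBanachAlgType R[i]) (reg : arens_regular A).
Local Notation C := R[i].

HB.instance Definition _ :=
  CompleteNormedModule.copy (arens_bidual reg) (cdual (cdual A)).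
HB.instance Definition _ := hasComBanachMul.Build C (arens_bidual reg)
  (@arens1A _ A) (arens1C reg) (@arens1Dl _ A) (@arens1Zl _ A)
  (@ler_norm_arens1 _ A).

Lemma char_hat_is_char (phi : character A) :
  (fun F : arens_bidual reg => F (char_dual phi) : C^o)
    \in @is_char R (arens_bidual reg).
Proof.
apply/asboolP; split => [a F G //|F G|].
- have e1 x : ract (char_dual phi) x = phi x *: char_dual phi.
    by apply: cdual_eq => y; exact: charM.
  have e2 : bidual_ract G (char_dual phi) = G (char_dual phi) *: char_dual phi.
    apply: cdual_eq => x; rewrite cdualZE -[LHS]/(G (ract (char_dual phi) x)).
    by rewrite e1 linearZ mulrC.
  rewrite -[LHS]/(F (bidual_ract G (char_dual phi))) e2 linearZ.
  exact: mulrC.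
- have [x px] := char_neq0 phi.
  have l : linear (fun f : cdual A => f x : C^o) by [].
  have b (f : cdual A) : `|f x| <= `|x| * `|f|.
    by rewrite mulrC ler_norm_cdual.
  by exists (bounded_cdual l b).
Qed.

Definition char_hat (phi : character A) : character (arens_bidual reg) :=
  Character (char_hat_is_char phi).

End ArensBidual.

(* Main.v *)
Require Import Defs.
From HB Require Import structures.
From mathcomp Require Import all_boot all_order all_algebra.
From mathcomp Require Import complex.
From mathcomp Require Import all_classical all_reals all_analysis.
Import Order.TTheory GRing.Theory Num.Theory.
Import numFieldNormedType.Exports.
Local Open Scope classical_set_scope.
Local Open Scope complex_scope.
Local Open Scope ring_scope.

(* Write [iota : A -> A**] for the canonical embedding, a homomorphism of norm
   at most 1. Since [A] is unital, [psi \o iota] is a character of [A] for every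
   character [psi] of [A**], so a BSE function [sigma] on the spectrum of [A]
   pulls back to the BSE function [psi |-> sigma (psi \o iota)] on that of
   [A**], with the same constant. As [A**] is BSE, this pullback is the Gelfand
   transform of some [F]; evaluating at the characters [char_hat phi], whose
   restriction to [A] is [phi], gives [sigma phi = F phi], and by hypothesis
   some [a] in [A] has the same values. *)

Section UnitalSpectrum.
Set Implicit Arguments.
Unset Strict Implicit.
Context {R : realType} {B : comBanachAlgType R[i]}.
Local Notation C := R[i].
Implicit Types (phi : character B) (b e x : B).

Lemma char_unit phi e : (forall x, bmul e x = x) -> phi e = 1.
Proof.
move=> e1; have [x px] := char_neq0 phi.
by apply: (mulIf px); rewrite -charM e1 mul1r.
Qed.

(** Evaluate [mult_hatE] at the unit, where every character is 1. *)
Lemma mult_hat_unit (T : {linear B -> B}) e :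
  (forall x, bmul e x = x) -> multiplier T -> mult_hat T = gelfand (T e).
Proof.
move=> e1 TM; apply/funext => phi.
by rewrite /gelfand (mult_hatE phi e TM) (char_unit phi e1) mulr1.
Qed.

Lemma gelfand_is_mult_hat e b :
  (forall x, bmul e x = x) -> ((@mult_hat R B) @` (@multiplier R B)) (gelfand b).
Proof.
move=> e1.
have lin : linear (bmul b) by move=> a x y; rewrite bmulDr bmulZr.
pose T : {linear B -> B} :=
  HB.pack (bmul b) (GRing.isLinear.Build C B B _ (bmul b) lin).
have TM : multiplier T by move=> x y /=; rewrite !bmulA (bmulC b).
exists T => //; rewrite (mult_hat_unit e1 TM).
by congr gelfand; rewrite /= bmulC e1.
Qed.

(** The transform of [b] is the inclusion of the spectrum into the product space, followed by the
    projection to coordinate [b]. *)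
Lemma continuous_gelfand b : continuous (gelfand b).
Proof.
move=> phi.
apply: (@continuous_comp _ {ptws B -> C^o} C^o (@char_val R B) (fun f => f b)).
  exact: (@initial_continuous _ {ptws B -> C^o} (@char_val R B) phi).
exact: (@proj_continuous B (fun=> C^o) b).
Qed.

Lemma gelfand_BSE b : C_BSE (gelfand b).
Proof.
split.
  split; first exact: continuous_gelfand.
  apply: filterS (nbhs_pinfty_ge (normr_real b)) => M bM phi _.
  by apply: le_trans (ler_norm_char phi b) _; rewrite mul1r.
(* Evaluating a combination of characters at [b] costs a factor [|b|]; adding 1 keeps the BSE
   constant positive when [b = 0]. *)
have b1 : `|b| <= (complex.Re (`|b| + 1))%:C.
  by rewrite RRe_real ?lerDl// ger0_real// addr_ge0.
exists (complex.Re (`|b| + 1)).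
  by rewrite -ltcR RRe_real ?ger0_real ?addr_ge0// ltr_wpDl.
move=> n c phi.
have -> : \sum_(j < n) c j * gelfand b (phi j) =
    (\sum_(j < n) c j *: char_dual (phi j)) b by rewrite cdual_sumE.
by rewrite (le_trans (ler_norm_cdual _ _))// mulrC ler_wpM2r.
Qed.

End UnitalSpectrum.

Section BidualEmbedding.
Set Implicit Arguments.
Unset Strict Implicit.
Context {R : realType} {V : normedModType R[i]}.
Local Notation C := R[i].

Lemma bidual_embed_linear (x : V) : linear (fun f : cdual V => f x : C^o).
Proof. by []. Qed.

Lemma bidual_embed_bound (x : V) (f : cdual V) : `|f x| <= `|x| * `|f|.
Proof. by rewrite mulrC ler_norm_cdual. Qed.

Definition bidual_embed (x : V) : cdual (cdual V) :=
  bounded_cdual (bidual_embed_linear x) (bidual_embed_bound x).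

Lemma bidual_embedP (a : C) (x y : V) :
  bidual_embed (a *: x + y) = a *: bidual_embed x + bidual_embed y.
Proof. by apply: cdual_eq => f; rewrite cdualDE cdualZE /= linearP. Qed.

Lemma ler_norm_bidual_embed (x : V) : `|bidual_embed x| <= `|x|.
Proof. by apply: ler_cdual_norm => // f; exact: bidual_embed_bound. Qed.

End BidualEmbedding.

Section BidualRestriction.
Set Implicit Arguments.
Unset Strict Implicit.
Context {R : realType} {A : comBanachAlgType R[i]} (reg : arens_regular A).
Context {e : A} (e1 : forall x, bmul e x = x).
Local Notation C := R[i].
Local Notation AA := (arens_bidual reg).

Lemma bidual_embedM (x y : A) :
  bidual_embed (bmul x y) = bmul (bidual_embed x : AA) (bidual_embed y : AA).
Proof. by apply: cdual_eq. Qed.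

(** By definition of the first Arens product, the left side sends [f] to [F (ract f e)], and
    [ract f e = f]. *)
Lemma bidual_embed_unit (F : AA) : bmul (bidual_embed e : AA) F = F.
Proof.
apply: cdual_eq => f; rewrite -[LHS]/(F (ract f e)); congr (F _).
by apply: cdual_eq => x /=; rewrite e1.
Qed.

Lemma char_restr_is_char (psi : character AA) :
  (fun x : A => psi (bidual_embed x : AA) : C^o) \in @is_char R A.
Proof.
apply/asboolP; split=> [a x y|x y|].
- by rewrite bidual_embedP; exact: (char_linear psi).
- by rewrite bidual_embedM charM.
(* The unit prevents the restriction from vanishing: [psi] is 1 at the image of [e]. *)
- by exists e; rewrite (char_unit psi bidual_embed_unit) oner_neq0.
Qed.

Definition char_restr (psi : character AA) : character A :=
  Character (char_restr_is_char psi).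

Lemma char_hatK : cancel (char_hat reg) char_restr.
Proof. by move=> phi; apply/val_inj/funext. Qed.

(** For the initial topology it suffices to check coordinates, and coordinate [x] is the Gelfand
    transform of [bidual_embed x]. *)
Lemma continuous_char_restr : continuous char_restr.
Proof.
apply: continuous_comp_initial => psi.
pose r : character AA -> {ptws A -> C^o} := @char_val R A \o char_restr.
have rF : Filter (r @ psi) by apply: fmap_filter; apply: nbhs_filter.
suff : {ptws, r @ psi --> r psi} by [].
apply/pointwise_cvgP => x.
exact: (@continuous_gelfand _ _ (bidual_embed x : AA) psi).
Qed.

Lemma BSE_comp_char_restr (sigma : character A -> C^o) :
  C_BSE sigma -> C_BSE (sigma \o char_restr).
Proof.
case=> -[sc sb] [beta beta0 sbeta]; split.
  split.
    by move=> psi; apply: continuous_comp;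
      [exact: continuous_char_restr|exact: sc].
  case: sb => M [Mreal sM]; exists M; split=> // N MN psi _.
  exact: sM N MN (char_restr psi) I.
(* The same [beta] works: composing a functional on the bidual with the contraction [bidual_embed]
   does not increase its norm. *)
exists beta => // n c psi; apply: le_trans (sbeta n c _) _.
apply: ler_wpM2l; first by rewrite ler0c ltW.
apply: ler_cdual_norm => // x.
have -> : (\sum_(j < n) c j *: char_dual (char_restr (psi j))) x =
    (\sum_(j < n) c j *: char_dual (psi j)) (bidual_embed x).
  by rewrite !cdual_sumE.
rewrite (le_trans (ler_norm_cdual _ _))// ler_wpM2l//.
exact: ler_norm_bidual_embed.
Qed.

End BidualRestriction.

Theorem lemma6 (R : realType) (A : comBanachAlgType R[i])
    (A_unital : unital A)
    (A_regular : arens_regular A)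
    (bidual_semisimple : semisimple (arens_bidual A_regular))
    (bidual_BSE : BSE_algebra (arens_bidual A_regular))
    (gelfand_eq :
      [set gelfand a | a in [set: A]] =
      [set (fun phi : character A => gelfand F (char_hat A_regular phi))
         | F in [set: arens_bidual A_regular]]) :
  BSE_algebra A.
Proof.
have [e e1] := A_unital; rewrite /BSE_algebra eqEsubset; split.
  by move=> _ [T TM <-]; rewrite (mult_hat_unit e1 TM); exact: gelfand_BSE.
move=> sigma /(BSE_comp_char_restr A_regular e1).
rewrite -bidual_BSE => -[T TM].
rewrite (mult_hat_unit (@bidual_embed_unit R A A_regular e e1) TM).
(* [F] is the value of [T] at the unit of the bidual, so [TF] reads
   [gelfand F = sigma \o char_restr]. *)
set F := T _ => TF.
have : [set gelfand a | a in [set: A]] sigma.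
  rewrite gelfand_eq; exists F => //; apply/funext => phi.
  by rewrite TF /= char_hatK.
by case=> a _ <-; exact: (gelfand_is_mult_hat a e1).
Qed.
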